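(* Let $\varphi:\mathbb{R}^+\to\mathbb{R}^+$ be a function that is continuous at $0$. Let $f:\mathbb{R}^+\to\mathbb{R}^+$ be a function (for which the Hirsch function $h_f$ is defined) that is continuous at the point $\varphi(0)$. Then the following two statements are equivalent: (i) $h_f=\varphi$ on $\mathbb{R}_0^+$; (ii) for all $\theta\in\mathbb{R}^+$, $f(\varphi(\theta))=\theta\cdot\varphi(\theta)$.
   Context: $\mathbb{R}^+=[0,+\infty[$ and $\mathbb{R}_0^+=\mathbb{R}^+\setminus\{0\}$. For a function $f:\mathbb{R}^+\to\mathbb{R}^+$, the Hirsch function $h_f:\mathbb{R}_0^+\to\mathbb{R}^+$ is defined, for $\theta\in\mathbb{R}_0^+$, by: $x=h_f(\theta)\Leftrightarrow f(x)=\theta x$. Only functions $f$ are considered for which this equation has a unique solution $x$ for every $\theta\in\mathbb{R}_0^+$, with the following convention: if $f(0)=0$ (so that $x=0$ always solves the equation), the solution $x=0$ is disregarded whenever a solution $x>0$ exists, and $h_f(\theta)=0$ if $x=0$ is the only solution.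
   Formalization: Statement (ii) additionally requires that, for θ>0, if φ(θ)=0 then f(x)=θx has no solution x>0; without this (ii)⇒(i) fails, e.g. for f(x)=x² and φ=0. *)

(* Defs.v *)
From HB Require Import structures.
From mathcomp Require Import all_boot all_order all_algebra.
From mathcomp Require Import all_classical all_reals all_analysis.

Set Implicit Arguments.
Unset Strict Implicit.
Unset Printing Implicit Defensive.

Import Order.TTheory GRing.Theory Num.Theory.
Import numFieldNormedType.Exports.

Local Open Scope classical_set_scope.
Local Open Scope ring_scope.

(** Functions from [0, +oo[ to itself are functions [R -> R] that preserve
    nonnegativity; their values at negative reals are never used. *)
Definition nonneg_fun (R : realType) (f : R -> R) : Prop :=
  forall x, 0 <= x -> 0 <= f x.

(** Continuity for the topology of [0, +oo[, hence one-sided at 0. *)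
Definition nonneg_continuous_at (R : realType) (f : R -> R) (a : R) : Prop :=
  f @ within `[0, +oo[%classic (nbhs a) --> f a.

Definition has_pos_solution (R : realType) (f : R -> R) (theta : R) : Prop :=
  exists2 y, 0 < y & f y = theta * y.

(** Convention for the equation [f x = theta * x] with [0 < theta]: the solution
    0, which exists exactly when [f 0 = 0], is disregarded as soon as there is a
    positive solution. *)
Definition hirsch_solution (R : realType) (f : R -> R) (theta : R) : set R :=
  [set x | [/\ 0 <= x, f x = theta * x & x = 0 -> ~ has_pos_solution f theta]].

Definition hirsch_defined (R : realType) (f : R -> R) : Prop :=
  forall theta, 0 < theta -> exists! x, hirsch_solution f theta x.

(** Meaningful only if [hirsch_defined f] and [0 < theta]; the default value of
    [xget] is irrelevant then. *)
Definition hirsch (R : realType) (f : R -> R) (theta : R) : R :=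
  xget 0 (hirsch_solution f theta).

(* Main.v *)
Require Import Defs.
From HB Require Import structures.
From mathcomp Require Import all_boot all_order all_algebra.
From mathcomp Require Import all_classical all_reals all_analysis.

Set Implicit Arguments.
Unset Strict Implicit.
Unset Printing Implicit Defensive.

Import Order.TTheory GRing.Theory Num.Theory.
Import numFieldNormedType.Exports.

Local Open Scope classical_set_scope.
Local Open Scope ring_scope.

(** For [theta > 0], both directions unfold the unique solvability of [f x = theta * x]. Only the
    equation at 0 needs continuity: as [t] tends to 0 from the right, [f (phi t) = t * phi t] tends
    both to [f (phi 0)] and to [0 * phi 0]. The first limit composes one-sided continuities, which
    [nonneg_continuous_at_cvg] allows because [phi] stays in the half-line. *)

Lemma nonneg_continuous_at_cvg (R : realType) (f : R -> R) (a : R)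
    (T : Type) (F : set_system T) (FF : Filter F) (g : T -> R) :
  nonneg_continuous_at f a -> g @ F --> a -> (\forall t \near F, 0 <= g t) ->
  f \o g @ F --> f a.
Proof.
move=> fa ga g_ge0 A /fa Afa.
have := ga _ Afa; rewrite /= !nbhs_simpl /= => gA.
apply: filterS2 g_ge0 gA => t gt /=; apply.
by rewrite in_itv /= gt.
Qed.

Lemma hirsch_solutionP (R : realType) (f : R -> R) (theta : R) :
  hirsch_defined f -> 0 < theta -> hirsch_solution f theta (hirsch f theta).
Proof.
move=> f_hirsch /f_hirsch[x [xsol _]].
by rewrite /hirsch; case: xgetP => [y _ //|/(_ x)].
Qed.

(** The second conjunct carries the convention on the solution 0: for [f x = x ^ 2] and [phi = 0]
    the equation always holds, yet [hirsch f theta = theta]. *)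
Theorem theorem1 (R : realType) (phi f : R -> R)
    (phi_ge0 : nonneg_fun phi)
    (phi_cont : nonneg_continuous_at phi 0)
    (f_ge0 : nonneg_fun f)
    (f_hirsch : hirsch_defined f)
    (f_cont : nonneg_continuous_at f (phi 0)) :
  (forall theta, 0 < theta -> hirsch f theta = phi theta)
  <->
  ((forall theta, 0 <= theta -> f (phi theta) = theta * phi theta) /\
   (forall theta, 0 < theta -> phi theta = 0 -> ~ has_pos_solution f theta)).
Proof.
split=> [hphi|[fphi phi0] theta theta_gt0]; last first.
  (* [hirsch f theta] and [phi theta] both solve the equation under the convention, so uniqueness
     identifies them. *)
  have [x [_ uniq_x]] := f_hirsch _ theta_gt0.
  rewrite -(uniq_x _ (hirsch_solutionP f_hirsch theta_gt0)); apply: uniq_x.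
  split; [exact/phi_ge0/ltW | exact/fphi/ltW | exact: phi0].
have sol theta : 0 < theta -> hirsch_solution f theta (phi theta).
  by move=> theta_gt0; rewrite -hphi//; exact: hirsch_solutionP.
split=> [theta|theta theta_gt0]; last by have [] := sol _ theta_gt0.
rewrite le_eqVlt => /predU1P[<-|/sol[]//].
(* Statement (i) only concerns positive arguments: the equation at 0 is the
   limit of the equations at [t > 0] as [t] tends to 0. *)
have phi_right : phi @ 0^'+ --> phi 0.
  move=> A /phi_cont; rewrite /= !nbhs_simpl /at_right /within /=.
  apply: filterS => x Ax x_gt0; apply: Ax.
  by rewrite /= in_itv /= andbT ltW.
have fphi_right : f \o phi @ 0^'+ --> f (phi 0).
  apply: nonneg_continuous_at_cvg => //.
  by near=> t; apply/phi_ge0/ltW.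
have prod_right : (fun t => t * phi t) @ 0^'+ --> 0 * phi 0.
  by apply: cvgM => //; exact: cvg_within.
(* The two functions agree at every [t > 0], so their limits coincide. *)
apply: (cvg_unique (@norm_hausdorff _ _) fphi_right); apply: cvg_trans prod_right.
apply: near_eq_cvg; near=> t.
have t_gt0 : 0 < t by [].
by rewrite /=; have [_ -> _] := sol _ t_gt0.
Unshelve. all: by end_near. Qed.
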